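(* Let $s\ge2$, let $\widetilde{\mathbb{T}}^s$ be the derooted $s$-Fuss-Catalan tree with root $\emptyset_{\widetilde{\mathbb{T}}^s}$, let $w$ be a vertex of $\widetilde{\mathbb{T}}^s$, and let $n\ge\frac{|w|-1}{2}$ be an integer. Put $${n\brack w}_{\#}=\frac{r(w)-1}{(s+1)\left(n-\lceil\frac{|w|-1}{2}\rceil\right)+r(w)-1}\binom{(s+1)\left(n-\lceil\frac{|w|-1}{2}\rceil\right)+r(w)-1}{n-\lceil\frac{|w|-1}{2}\rceil}.$$ Then $${n\brack w}_{\#}=\begin{cases}\mathrm{Wk}_{\widetilde{\mathbb{T}}^s}(2n,\emptyset_{\widetilde{\mathbb{T}}^s},w)&\text{if }|w|\text{ is odd},\\ \mathrm{Wk}_{\widetilde{\mathbb{T}}^s}(2n-1,\emptyset_{\widetilde{\mathbb{T}}^s},w)&\text{if }|w|\text{ is even}.\end{cases}$$ In particular (case $s=2$), for a generic loop parameter $\delta$, the dimension of the irreducible representation of $A_{(\mathcal{B}^\#,\delta)}(2n)$ indexed by $(2n,w)$ with $|w|$ odd is $$\frac{r(w)-1}{3\left(n-\lceil\frac{|w|-1}{2}\rceil\right)+r(w)-1}\binom{3\left(n-\lceil\frac{|w|-1}{2}\rceil\right)+r(w)-1}{n-\lceil\frac{|w|-1}{2}\rceil}.$$ The same formula holds for the dimension of the irreducible representation of $A_{(\mathcal{B}^\#,\delta)}(2n-1)$ indexed by $(2n-1,w)$ with $|w|$ even.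
   Context: Trees: the $s$-Fuss-Catalan tree $\mathbb{T}^s$ is the rooted tree with labelled vertices defined inductively: the root $\emptyset$ has label $1$; a vertex of label $i$ has exactly $i$ children, labelled $s,s-1,\dots,s-i+1$. For a vertex $w$ of $\mathbb{T}^s$, $|w|$ is its distance to $\emptyset$ in $\mathbb{T}^s$, and $r(w)$ is the sum of the labels of all vertices on the path from $\emptyset$ to $w$ (both included). The derooted tree $\widetilde{\mathbb{T}}^s$ is obtained by deleting $\emptyset$ and its adjacent edge; its root is the unique vertex of $\mathbb{T}^s$ at distance $1$ from $\emptyset$. For vertices $w$ of $\widetilde{\mathbb{T}}^s$, $|w|$ and $r(w)$ are still computed in $\mathbb{T}^s$, so the distance of $w$ to the root of $\widetilde{\mathbb{T}}^s$ is $|w|-1$. $\mathrm{Wk}_{T}(m,v,w)$ is the number of (nearest neighbour) walks of length $m$ from $v$ to $w$ on the tree $T$. For $s=2$, $\mathbb{T}^2$ is the Fibonacci tree and $\widetilde{\mathbb{T}}^2=\mathbb{FT}^*$ is the derooted Fibonacci tree. The algebras: $\mathcal{B}^\#(n,n)$ is the set of noncrossing partitions of $n$ upper points $1,\dots,n$ and $n$ lower points $1',\dots,n'$ (noncrossing with respect to the order $1<\dots<n<n'<\dots<1'$) with blocks of size one or two, such that when the boundary points are labelled counterclockwise alternately $a,b,a,b,\dots$ starting with $a$ at the upper right corner, every block of size two joins an $a$ to a $b$. $A_{(\mathcal{B}^\#,\delta)}(n)$ has basis $e_p$, $p\in\mathcal{B}^\#(n,n)$, with product given by vertical stacking and a factor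 $\delta$ for each erased connected component not connected to outer points; level $n$ embeds into level $n+1$ by adding a through-string on the right. $\delta>0$ is generic if all these algebras are semisimple. The branching graph of this tower (level-$n$ vertices: irreducible modules of the $n$-th algebra; number of edges: multiplicities under restriction to the previous algebra) is isomorphic to the pascalization $\mathcal{P}(\mathbb{FT}^* )$, whose level-$N$ vertices are the pairs $(N,w)$ with $w$ a vertex of $\mathbb{FT}^*$ at distance $k\le N$, $k\equiv N\bmod2$, from its root, and with $(N,w)$ joined to $(N+1,w')$ iff $w,w'$ are neighbours in $\mathbb{FT}^*$. Irreducible representations are indexed by these vertices via such an isomorphism. *)

(* Defs.v *)
From HB Require Import structures.
From mathcomp Require Import all_boot all_order all_algebra.
From mathcomp Require Import finmap.
From mathcomp Require Import boolp classical_sets cardinality reals.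
From mathcomp.real_closed Require Import complex.

Set Implicit Arguments.
Unset Strict Implicit.
Unset Printing Implicit Defensive.

Import Order.TTheory GRing.Theory Num.Theory.

Local Open Scope ring_scope.

(* A walk is given by its list of successive vertices after the starting point.
   [fset_set] sends infinite sets to the empty one, so [Wk] is meaningful for
   locally finite graphs only. *)
Definition Wk (T : choiceType) (adj : rel T) (m : nat) (v w : T) : nat :=
  #|` fset_set
        [set p : seq T | [/\ size p = m, path adj v p & last v p = w]]%classic |.

(* The children of a vertex have pairwise distinct labels, so a vertex of T^s
   is encoded by the word of the labels met on the path from the root to it,
   the label 1 of the root being omitted. *)
Section FussCatalanTree.
Variable s : nat.

(* a vertex of label i has children of labels s, s - 1, ..., s - i + 1 *)
Definition child_label : rel nat := fun i j => (j <= s < i + j)%N.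

Definition fctree := {w : seq nat | path child_label 1%N w}.

Definition depth (w : fctree) : nat := size (val w).

Definition label_sum (w : fctree) : nat := sumn (1%N :: val w).

Definition is_child (u v : fctree) : bool :=
  prefix (val u) (val v) && (depth v == (depth u).+1).

Definition adjacent : rel fctree := fun u v => is_child u v || is_child v u.

Definition derooted := {w : fctree | val w != [::]}.

Lemma derooted_root_subproof : path child_label 1%N [:: s].
Proof. by rewrite /= /child_label leqnn add1n ltnSn. Qed.

Definition derooted_root : derooted :=
  Sub (Sub [:: s] derooted_root_subproof : fctree) isT.

Definition derooted_adjacent : rel derooted :=
  fun u v => adjacent (val u) (val v).

Definition fuss_bracket (n : nat) (w : derooted) : rat :=
  let k := (n - uphalf (depth (val w)).-1)%N in
  let r1 := (label_sum (val w)).-1 in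
  r1%:R / ((s + 1) * k + r1)%N%:R * 'C((s + 1) * k + r1, k)%:R.

End FussCatalanTree.

Section SharpPartitions.
Variable n : nat.

(* inl i : upper point i + 1;  inr i : lower point (i + 1)' *)
Definition boundary := ('I_n + 'I_n)%type.

(* rank in the order 1 < ... < n < n' < ... < 1' *)
Definition planar_rank (x : boundary) : nat :=
  match x with inl i => i | inr i => (n.*2 - i.+1)%N end.

(* rank in the counterclockwise order n, ..., 1, 1', ..., n' starting at the
   upper right corner; even ranks carry the label a and odd ranks the label b *)
Definition ccw_rank (x : boundary) : nat :=
  match x with inl i => (n - i.+1)%N | inr i => (n + i)%N end.

Definition noncrossing (p : {set {set boundary}}) : bool :=
  [forall B1 in p, forall B2 in p,
     [exists x in B1, exists z in B1, exists y in B2, exists t in B2,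
        [&& planar_rank x < planar_rank y, planar_rank y < planar_rank z
          & planar_rank z < planar_rank t]%N] ==> (B1 == B2)].

Definition label_alternating (p : {set {set boundary}}) : bool :=
  [forall B in p, (#|B| == 2)%N ==> (#|[set x in B | odd (ccw_rank x)]| == 1)%N].

Definition is_sharp (p : {set {set boundary}}) : bool :=
  [&& finset.partition p [set: boundary], [forall B in p, (#|B| <= 2)%N],
      noncrossing p & label_alternating p].

Definition sharp := {p : {set {set boundary}} | is_sharp p}.

(* The three rows of points obtained by stacking a diagram on top of another:
   top, middle (the identified points) and bottom. *)
Definition stack_point := ('I_n + 'I_n + 'I_n)%type.
Definition top (i : 'I_n) : stack_point := inl (inl i).
Definition mid (i : 'I_n) : stack_point := inl (inr i).
Definition bot (i : 'I_n) : stack_point := inr i.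

Definition in_upper (x : boundary) : stack_point :=
  match x with inl i => top i | inr i => mid i end.
Definition in_lower (x : boundary) : stack_point :=
  match x with inl i => mid i | inr i => bot i end.
Definition outer (x : boundary) : stack_point :=
  match x with inl i => top i | inr i => bot i end.

Definition same_block (f : boundary -> stack_point) (p : {set {set boundary}}) :
    rel stack_point :=
  fun x y => [exists B in p, (x \in f @: B) && (y \in f @: B)].

Definition stack_conn (p q : {set {set boundary}}) : rel stack_point :=
  connect (fun x y => same_block in_upper p x y || same_block in_lower q x y).

Definition stack (p q : {set {set boundary}}) : {set {set boundary}} :=
  equivalence_partition (fun x y => stack_conn p q (outer x) (outer y))
    [set: boundary].

Definition erased_components (p q : {set {set boundary}}) : nat :=
  #|[set K in equivalence_partition (stack_conn p q) [set: stack_point]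
      | K \subset mid @: 'I_n]|.

Definition identity_diagram : {set {set boundary}} :=
  [set [set (inl i : boundary); inr i] | i : 'I_n].

End SharpPartitions.

Definition widen_point n (x : boundary n) : boundary n.+1 :=
  match x with
  | inl i => inl (widen_ord (leqnSn n) i)
  | inr i => inr (widen_ord (leqnSn n) i)
  end.

Definition add_through_string n (p : {set {set boundary n}}) :
    {set {set boundary n.+1}} :=
  [set (inl ord_max : boundary n.+1); inr ord_max]
    |: [set (@widen_point n) @: B | B : {set boundary n} in p].

(* Submodules and homomorphisms for a family [rho] of operators on 'rV_d, with
   the conventions of mxrepresentation: operators act on the right on row
   vectors, and a subspace is the row space of a matrix. *)
Section Operators.
Variables (F : fieldType) (A : Type).

Definition submodule d (rho : A -> 'M[F]_d) (U : 'M[F]_d) : Prop :=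
  forall a, stablemx U (rho a).

Definition simple_submodule d (rho : A -> 'M[F]_d) (U : 'M[F]_d) : Prop :=
  [/\ submodule rho U, U != 0
    & forall V, submodule rho V -> (V <= U)%MS -> V != 0 -> (U <= V)%MS].

Definition irreducible d (rho : A -> 'M[F]_d) : Prop :=
  simple_submodule rho 1%:M.

Definition simple_decomposition d (rho : A -> 'M[F]_d)
    k (U : 'I_k -> 'M[F]_d) : Prop :=
  [/\ forall i, simple_submodule rho (U i), mxdirect (\sum_i U i)
    & ((\sum_i U i)%MS == (1%:M : 'M[F]_d))%MS].

Definition isomorphic_to_submodule e d (sigma : A -> 'M[F]_e)
    (rho : A -> 'M[F]_d) (U : 'M[F]_d) : Prop :=
  exists B : 'M[F]_(e, d),
    [/\ row_free B, (B == U)%MS & forall a, sigma a *m B = B *m rho a].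

Definition isomorphic e d (sigma : A -> 'M[F]_e) (rho : A -> 'M[F]_d) : Prop :=
  isomorphic_to_submodule sigma rho 1%:M.

(* the irreducible sigma occurs exactly m times in the semisimple rho *)
Definition has_multiplicity e d (sigma : A -> 'M[F]_e) (rho : A -> 'M[F]_d)
    (m : nat) : Prop :=
  exists k (U : 'I_k -> 'M[F]_d), simple_decomposition rho U /\
    #|[set i | `[< isomorphic_to_submodule sigma rho (U i) >]]| = m.

End Operators.

Section SharpAlgebra.
Variables (R : realType) (delta : R).

(* f stands for the linear combination of the basis vectors e_p with
   coefficients f p *)
Definition sharp_alg (n : nat) := {ffun sharp n -> R[i]^o}.

Definition alg_one n : sharp_alg n :=
  [ffun r => (val r == identity_diagram n)%:R].

(* bilinear extension of
   e_p e_q = delta ^ (erased_components p q) e_(stack p q) *)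
Definition alg_mul n (f g : sharp_alg n) : sharp_alg n :=
  [ffun r => \sum_p \sum_(q | stack (val p) (val q) == val r)
     (delta%:C)%C ^+ erased_components (val p) (val q) * f p * g q].

(* linear extension of e_p |-> e_(add_through_string p) *)
Definition alg_embed n (f : sharp_alg n) : sharp_alg n.+1 :=
  [ffun r => \sum_(p | add_through_string (val p) == val r) f p].

Record representation (n : nat) := Representation {
  rep_dim : nat;
  rep_mx :> {linear sharp_alg n -> 'M[R[i]]_rep_dim};
  rep_one : rep_mx (alg_one n) = 1%:M;
  rep_mul : forall f g, rep_mx (alg_mul f g) = rep_mx f *m rep_mx g
}.

Definition restriction n (V : representation n.+1) :
    sharp_alg n -> 'M[R[i]]_(rep_dim V) :=
  fun f => V (alg_embed f).

Definition semisimple (n : nat) : Prop :=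
  forall V : representation n,
    exists k (U : 'I_k -> 'M[R[i]]_(rep_dim V)), simple_decomposition V U.

Definition generic : Prop := 0 < delta /\ forall n, semisimple n.

(* (N, w) is a vertex of the pascalization of the derooted Fibonacci tree *)
Definition pascal_vertex (N : nat) (w : derooted 2) : bool :=
  let k := (depth (val w)).-1 in (k <= N)%N && (odd k == odd N).

(* [phi N w] is the irreducible representation indexed by the vertex (N, w); its
   values outside of the pascalization are irrelevant. *)
Record branching_isomorphism
    (phi : forall N : nat, derooted 2 -> representation N) : Prop := {
  branching_irreducible : forall N w, pascal_vertex N w ->
    irreducible (phi N w);
  branching_injective : forall N w w', pascal_vertex N w ->
    pascal_vertex N w' -> isomorphic (phi N w) (phi N w') -> w = w';
  branching_surjective : forall N (V : representation N), irreducible V ->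
    exists2 w, pascal_vertex N w & isomorphic V (phi N w);
  branching_edges : forall N w w', pascal_vertex N w ->
    pascal_vertex N.+1 w' ->
    has_multiplicity (phi N w) (restriction (phi N.+1 w'))
      (derooted_adjacent w w')
}.

End SharpAlgebra.

(* Main.v *)
Require Import Defs.
From HB Require Import structures.
From mathcomp Require Import finmap boolp classical_sets cardinality.
From mathcomp Require Import all_boot all_order all_algebra.
From mathcomp Require Import reals.
From mathcomp.real_closed Require Import complex.
From mathcomp Require Import zify ring.

Set Implicit Arguments.
Unset Strict Implicit.
Unset Printing Implicit Defensive.

Import GRing.Theory Num.Theory.
Local Open Scope ring_scope.

(** Write k for half the difference between the length of the walk and the
    distance of w to the root of the derooted tree, and r for the sum of the
    labels of w (the label 1 of the deleted vertex being left out).  For the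
    relevant lengths the bracket is the Raney number
      F(k, r) = r / ((s+1)k + r) * binomial((s+1)k + r, k),
    the coefficient of x^k in B(x)^r, where B = 1 + x B^(s+1).  These numbers
    satisfy F(k+1, r+1) = F(k+1, r) + F(k, r+1+s) ([raneyS]).

    Removing the last step of a walk gives
      Wk(m+1, w) = sum of Wk(m, u) over the neighbours u of w ([WkS]).
    If w has last label l, its parent has label sum r - l and its children have
    label sums r + c with s-l < c <= s.  On the side of the Raney numbers, this
    is exactly [raneyS] iterated l times ([raneyD]), and F(k+1, 0) = 0 accounts
    for the parent that the root lacks.  So both sides agree by induction on the
    length ([Wk_walk_number]).

    For the dimensions it is enough to see that the dimension of phi N w
    satisfies the same recursion.  Restricting phi (N+1) w' to level N and
    decomposing it into simple modules, every summand is some phi N w, and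
    phi N w occurs once if w and w' are neighbours, and does not occur otherwise;
    taking dimensions gives the recursion ([rep_dimS]).  Three points have to be
    settled on the way.
    - The multiplicities are given, for each w separately, by some decomposition
      of the restriction.  A single decomposition must serve for all w, so one
      needs that multiplicities do not depend on the decomposition: by Schur's
      lemma, the sum of the summands isomorphic to sigma contains every
      submodule isomorphic to sigma ([sub_isotypic]), hence is the same for all
      decompositions ([multiplicity_unique]).
    - A restriction must be a representation of the smaller algebra, that is,
      adding a through-string must be a unital morphism of algebras
      ([alg_embed_one], [alg_embed_mul]).  Diagrammatically, the new string only
      adds one connected component, which reaches the outer points, to any
      stacking of diagrams.
    - At level 0 the algebra consists of the scalars, so that its irreducible
      modules have dimension one ([irreducible_rep0_dim]). *)

(** * Walks in locally finite graphs *)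

Section LocallyFiniteWalks.
Variables (T : choiceType) (adj : rel T) (nbrs : T -> seq T).
Hypothesis nbrs_uniq : forall w, uniq (nbrs w).
Hypothesis mem_nbrs : forall u w, (u \in nbrs w) = adj u w.

(** The walks of length [m] from [v] to [w], grouped by their last vertex but one:
    an explicit duplicate-free list shows that the set counted by [Wk] is finite. *)
Fixpoint walks (v : T) (m : nat) (w : T) : seq (seq T) :=
  if m is m'.+1 then [seq rcons p w | u <- nbrs w, p <- walks v m' u]
  else if v == w then [:: [::]] else [::].

Lemma walksP v m w p :
  reflect [/\ size p = m, path adj v p & last v p = w] (p \in walks v m w).
Proof.
elim: m w p => [|m IHm] w p /=.
  case: eqP => [->|vNw]; rewrite ?inE; last by right; case=> /size0nil -> _ /= /vNw.
  by apply: (iffP eqP) => [->|[/size0nil]].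
apply: (iffP allpairsPdep) => [[u [q [uw /IHm[szq pq lq] ->]]]|].
  by rewrite size_rcons szq rcons_path pq lq last_rcons -mem_nbrs.
case/lastP: p => [|q x]; first by case.
rewrite size_rcons rcons_path last_rcons => -[[szq] /andP[pq xw] <-].
by exists (last v q), q; rewrite mem_nbrs; split=> //; apply/IHm.
Qed.

Lemma walks_uniq v m w : uniq (walks v m w).
Proof.
elim: m w => [|m IHm] w /=; first by case: eqP.
apply: allpairs_uniq_dep => //= x y /allpairsPdep[u [p [_ /walksP[_ _ lp] {x}->]]].
move=> /allpairsPdep[u' [p' [_ /walksP[_ _ lp'] {y}->]]] /rcons_inj[/= pp'].
by rewrite -lp -lp' pp'.
Qed.

Lemma Wk_size v m w : Wk adj m v w = size (walks v m w).
Proof.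
rewrite /Wk.
suff -> : [set p : seq T | [/\ size p = m, path adj v p & last v p = w]]%classic
   = [set` [fset p in walks v m w]%fset]%classic.
  rewrite set_fsetK card_fseq undup_id ?walks_uniq//.
by apply/seteqP; split=> p /=; rewrite in_fset => /walksP.
Qed.

Lemma Wk0 v w : Wk adj 0 v w = (v == w).
Proof. by rewrite Wk_size /=; case: eqP. Qed.

Lemma WkS v m w : Wk adj m.+1 v w = \sum_(u <- nbrs w) Wk adj m v u.
Proof.
rewrite Wk_size /= size_allpairs_dep sumnE big_map.
by apply: eq_bigr => u _; rewrite Wk_size.
Qed.
End LocallyFiniteWalks.

(** * Raney numbers *)

Definition raney (s k r : nat) : rat :=
  r%:R / ((s + 1) * k + r)%N%:R * 'C((s + 1) * k + r, k)%:R.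

Lemma raney0r s r : (0 < r)%N -> raney s 0 r = 1.
Proof.
by move=> r0; rewrite /raney muln0 add0n bin0 mulr1 divff // pnatr_eq0 -lt0n.
Qed.

Lemma raneyr0 s k : raney s k 0 = 0.
Proof. by rewrite /raney !mul0r. Qed.

(** With N = (s+1)(k+1) + r, the three binomials involved are rational multiples
    of binomial(N, k), and the identity becomes one of rational functions. *)
Lemma raneyS s k r : (0 < s)%N ->
  raney s k.+1 r.+1 = raney s k.+1 r + raney s k (r.+1 + s).
Proof.
move=> s0; rewrite /raney.
set N := ((s + 1) * k.+1 + r)%N.
have -> : ((s + 1) * k.+1 + r.+1 = N.+1)%N by rewrite /N addnS.
have -> : ((s + 1) * k + (r.+1 + s) = N)%N by rewrite /N; lia.
have hN : (k < N)%N by rewrite /N; lia.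
have N0 : N%:R != 0 :> rat by rewrite pnatr_eq0; lia.
have S0 : N.+1%:R != 0 :> rat by rewrite pnatr_eq0.
have K0 : k.+1%:R != 0 :> rat by rewrite pnatr_eq0.
have eA : 'C(N.+1, k.+1)%:R = N.+1%:R / k.+1%:R * 'C(N, k)%:R :> rat.
  apply: (mulfI K0); rewrite mulrA mulrCA divff // mulr1 -!natrM.
  by rewrite mul_bin_diag.
have eB : 'C(N, k.+1)%:R = (N%:R - k%:R) / k.+1%:R * 'C(N, k)%:R :> rat.
  apply: (mulfI K0); rewrite mulrA mulrCA divff // mulr1 -natrB; last by lia.
  by rewrite -!natrM mul_bin_left.
rewrite {}eA {}eB.
have -> : r.+1%:R = N.+1%:R - (s%:R + 1) * k.+1%:R :> rat.
  by rewrite -(natrD _ s 1) -natrM -natrB; [congr _%:R|]; rewrite /N; lia.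
have -> : r%:R = N%:R - (s%:R + 1) * k.+1%:R :> rat.
  by rewrite -(natrD _ s 1) -natrM -natrB; [congr _%:R|]; rewrite /N; lia.
have -> : (r.+1 + s)%:R = N%:R - (s%:R + 1) * k%:R :> rat.
  by rewrite -(natrD _ s 1) -natrM -natrB; [congr _%:R|]; rewrite /N; lia.
move: K0 S0; rewrite -!natr1 => K0 S0; field.
by rewrite K0 S0 N0.
Qed.

(** The sum runs over the labels of the children of a vertex of label [l]. *)
Lemma raneyD s k r l : (0 < s)%N -> (l <= s)%N ->
  raney s k.+1 (r + l) =
  raney s k.+1 r + \sum_(c <- iota (s.+1 - l) l) raney s k (r + l + c).
Proof.
move=> s0; elim: l r => [|l IHl] r ls; first by rewrite addn0 big_nil addr0.
rewrite addnS raneyS // IHl; last by lia.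
rewrite -addrA subSS; congr (_ + _).
have -> : iota (s - l) l.+1 = rcons (iota (s - l) l) s.
  by rewrite -addn1 iotaD cats1 subnK //; lia.
rewrite big_rcons; congr (_ + _).
have -> : (s.+1 - l = (s - l).+1)%N by lia.
elim: l (s - l)%N (r + l)%N {ls IHl} => [|l IHl] a b; first by rewrite !big_nil.
rewrite /= !big_cons; congr (_ + _); last exact: IHl.
by rewrite addnS addSn.
Qed.

(** * The derooted tree and its walks *)

Section Tree.
Variable s : nat.

Definition word (w : derooted s) : seq nat := val (val w).

(** Neighbours are computed on words, free of the proofs that vertices carry, and
    converted back by [of_word]. *)
Definition of_word (x : seq nat) : option (derooted s) :=
  obind insub (insub x : option (fctree s)).

Lemma of_wordK : ocancel of_word word.
Proof.
move=> x; rewrite /of_word; case: (insubP (fctree s) x) => //= u _ <-.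
by case: (insubP (derooted s) u) => //= v _ <-.
Qed.

Lemma wordK : pcancel word of_word.
Proof. by move=> w; rewrite /of_word /word valK /= valK. Qed.

Lemma isSome_of_word x :
  of_word x = path (child_label s) 1%N x && (x != [::]) :> bool.
Proof.
rewrite /of_word; case: (insubP (fctree s) x) => [u -> <-|/negPf->] //=.
by case: (insubP (derooted s) u) => [v -> _|/negPf->].
Qed.

Lemma word_valid w : path (child_label s) 1%N (word w) && (word w != [::]).
Proof. by rewrite -isSome_of_word wordK. Qed.

Lemma word_labels_le w : all (leq^~ s) (word w).
Proof.
have /andP[+ _] := word_valid w.
by elim: (word w) 1%N => //= x p IHp i /andP[/andP[-> _]] /IHp.
Qed.

(** A sequence with at most one term, as the root of the derooted tree has no
    parent there. *)
Definition parent_word (x : seq nat) : seq (seq nat) :=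
  if (1 < size x)%N then [:: take (size x).-1 x] else [::].

Definition child_words (x : seq nat) : seq (seq nat) :=
  [seq rcons x c | c <- iota (s.+1 - last 1%N x) (last 1%N x)].

Definition nbr_words x := parent_word x ++ child_words x.

Definition nbrs (w : derooted s) := pmap of_word (nbr_words (word w)).

Lemma last_word_le w : (last 1%N (word w) <= s)%N.
Proof.
case: (lastP (word w)) (word_labels_le w) (word_valid w) => [_ /andP[]//|x c].
by rewrite all_rcons last_rcons => /andP[].
Qed.

Lemma nbr_words_valid w : all (fun x => of_word x) (nbr_words (word w)).
Proof.
rewrite all_cat; apply/andP; split.
  rewrite /parent_word; case: ltnP => //= sz; rewrite andbT isSome_of_word.
  have /andP[pw _] := word_valid w.
  move: pw; rewrite -{1}(cat_take_drop (size (word w)).-1 (word w)) cat_path.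
  move=> /andP[-> _].
  rewrite -size_eq0 size_takel ?leq_pred //=; lia.
apply/allP => _ /mapP[c + ->]; rewrite mem_iota => /andP[c1 c2].
rewrite isSome_of_word rcons_path -size_eq0 size_rcons andbT.
have /andP[-> _] := word_valid w; have := last_word_le w.
rewrite /child_label; lia.
Qed.

Lemma nbr_words_uniq w : uniq (nbr_words (word w)).
Proof.
rewrite cat_uniq map_inj_uniq ?iota_uniq; last by move=> c d /rcons_inj[].
rewrite andbT; apply/andP; split; first by rewrite /parent_word; case: ltnP.
apply/hasPn => _ /mapP[c _ ->]; rewrite /parent_word; case: ltnP => //= sz.
rewrite inE; apply/eqP => /(congr1 size).
rewrite size_rcons size_takel ?leq_pred //=; lia.
Qed.

Lemma mem_nbr_words u w : (word u \in nbr_words (word w)) = derooted_adjacent u w.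
Proof.
rewrite mem_cat /derooted_adjacent /adjacent /is_child /depth -!/(word _).
congr (_ || _).
  rewrite /parent_word; case: ltnP => sz.
    rewrite inE; apply/eqP/andP => [->|[/prefixP[t ->] /eqP]].
      rewrite size_takel ?leq_pred //=.
      by split; [exact: prefix_take | lia].
    by rewrite size_cat => ->; rewrite take_size_cat.
  apply/esym/negP => /andP[_ /eqP]; have /andP[_] := word_valid u.
  by rewrite -size_eq0 /=; lia.
apply/mapP/andP => [[c _ ->]|[/prefixP[t eu] /eqP]].
  by rewrite size_rcons eqxx -cats1 prefix_prefix.
rewrite eu size_cat => szt; case: t eu szt => [|c [|d t]] eu /= szt; try lia.
exists c; last by rewrite cats1.
have /andP[+ _] := word_valid u; rewrite eu cats1 rcons_path mem_iota => /andP[_].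
have := last_word_le w; rewrite /child_label; lia.
Qed.

Lemma nbrs_uniq w : uniq (nbrs w).
Proof. exact: (pmap_uniq of_wordK (nbr_words_uniq w)). Qed.

Lemma mem_nbrs u w : (u \in nbrs w) = derooted_adjacent u w.
Proof. by rewrite (can2_mem_pmap of_wordK wordK) mem_nbr_words. Qed.

Lemma big_nbrs (V : nmodType) (G : seq nat -> V) w :
  \sum_(u <- nbrs w) G (word u) = \sum_(x <- nbr_words (word w)) G x.
Proof.
rewrite -(big_map word predT) (pmap_filter of_wordK).
by have /all_filterP -> := nbr_words_valid w.
Qed.

Hypothesis s_gt0 : (0 < s)%N.

(** The candidate for the number of walks of length [m] from the root to the
    vertex of word [x]; unlike the bracket it is defined for all lengths, which
    the induction on the length requires. *)
Definition walk_number (m : nat) (x : seq nat) : rat :=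
  if ((size x).-1 <= m)%N && ~~ odd (m - (size x).-1)
  then raney s (m - (size x).-1)./2 (sumn x) else 0.

Lemma sumn_word_gt0 x : path (child_label s) 1%N x && (x != [::]) -> (0 < sumn x)%N.
Proof.
case: x => [|c x] //= /andP[/andP[+ _] _]; rewrite /child_label; lia.
Qed.

(** If the vertex is at distance [m.+1] from the root, walks of that length can only
    come from its parent; if it is nearer, [raneyD] splits the Raney number into the
    contribution of the parent and those of the children. *)
Lemma walk_numberS m w :
  walk_number m.+1 (word w) = \sum_(x <- nbr_words (word w)) walk_number m x.
Proof.
have := word_valid w; have := last_word_le w; move: (word w).
case/lastP => // x l; rewrite last_rcons => ls xP.
rewrite /nbr_words /child_words /parent_word big_cat big_map last_rcons size_rcons /=.
have -> : take (size x) (rcons x l) = x by rewrite -cats1 take_size_cat.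
have sxl : sumn (rcons x l) = (sumn x + l)%N by rewrite -cats1 sumn_cat /= addn0.
have -> : \sum_(p <- (if 1 < (size x).+1 then [:: x] else [::])%N) walk_number m p =
    if (size x <= m.+1)%N && ~~ odd (m.+1 - size x)
    then raney s (m.+1 - size x)./2 (sumn x) *+ (x != [::]) else 0.
  case: x {xP sxl} => [|c x]; first by rewrite big_nil mulr0n if_same.
  by rewrite big_seq1 /walk_number /= ltnS subSS.
have -> : \sum_(j <- iota (s.+1 - l) l) walk_number m (rcons (rcons x l) j) =
    \sum_(j <- iota (s.+1 - l) l)
    if ((size x).+1 <= m)%N && ~~ odd (m.+1 - size x)
    then raney s (m.+1 - size x)./2.-1 (sumn x + l + j) else 0.
  apply: eq_bigr => j _; rewrite /walk_number !size_rcons /=.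
  rewrite -(cats1 _ j) sumn_cat /= addn0 sxl.
  case: ltnP => //= h.
  have -> : (m.+1 - size x = (m - (size x).+1).+2)%N by lia.
  by rewrite /= negbK.
rewrite /walk_number size_rcons /= sxl.
case: (leqP (size x) m.+1) => [h1|h1] /=; last first.
  by rewrite add0r big1 // => j _; case: ifP => //; lia.
case odd: (odd _) => /=; first by rewrite add0r big1 // => j _; rewrite andbF.
case k: (m.+1 - size x)./2 => [|k'].
  rewrite big1 ?addr0; last by move=> j _; case: ifP => //; lia.
  case: x xP odd h1 sxl k => [|c x] xP odd h1 sxl k; first by move: odd k => /=; lia.
  rewrite !raney0r // -?sxl; try exact: sumn_word_gt0.
  apply: sumn_word_gt0; move: xP; rewrite rcons_path => /andP[/andP[-> _] _] //.
have -> : (size x < m)%N by lia.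
rewrite /= raneyD //; congr (_ + _).
(* the root has no parent, and the corresponding Raney number is zero *)
by case: (x) => //=; rewrite raneyr0.
Qed.

Lemma Wk_walk_number m w :
  (Wk (@derooted_adjacent s) m (derooted_root s) w)%:R = walk_number m (word w).
Proof.
elim: m w => [|m IHm] w.
  rewrite (Wk0 nbrs_uniq mem_nbrs) /walk_number sub0n /= leqn0 andbT.
  have -> : (derooted_root s == w) = (word w == [:: s]).
    by apply/eqP/eqP => [<- //|h]; apply: (pcan_inj wordK).
  have := sumn_word_gt0 (word_valid w); have := word_valid w.
  case: (word w) => [|c [|d x]] //= /andP[/andP[+ _] _] c0.
    rewrite raney0r // /child_label => h; have -> : c = s by lia.
    by rewrite eqxx.
  by move=> _; case: eqP.
rewrite (WkS nbrs_uniq mem_nbrs) natr_sum (eq_bigr _ (fun u _ => IHm u)).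
by rewrite (big_nbrs (walk_number m)) walk_numberS.
Qed.

End Tree.

Lemma fuss_bracket_walk_number s (w : derooted s) (n : nat) :
  (0 < s)%N -> ((depth (val w)).-1 <= 2 * n)%N ->
  fuss_bracket n w =
    walk_number s (if odd (depth (val w)) then 2 * n else 2 * n - 1)%N (word w).
Proof.
move=> s0; rewrite /fuss_bracket /walk_number /depth -/(word w) => h.
have := word_valid w; rewrite -size_eq0 /= => /andP[_ w0].
rewrite /label_sum /= -/(word w).
set m := (if odd _ then _ else _).
have -> : ((size (word w)).-1 <= m)%N && ~~ odd (m - (size (word w)).-1).
  by rewrite /m; case: ifP; lia.
rewrite /raney; congr (_ / (_ * _ + _)%N%:R * 'C(_ * _ + _, _)%:R); rewrite ?add0n //.
all: by rewrite /m; case: ifP; lia.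
Qed.

(** * Multiplicities in semisimple modules *)

Section Operators.
Variables (F : fieldType) (A : Type).
Implicit Types (a : A).

Lemma isomorphic_to_submodule_rank e d (sigma : A -> 'M[F]_e) (rho : A -> 'M[F]_d) U :
  isomorphic_to_submodule sigma rho U -> \rank U = e.
Proof. by case=> B [Bfree /eqmxP eBU _]; rewrite -eBU; apply/eqP. Qed.

Lemma isomorphic_to_submodule_trans e1 e2 d (sigma : A -> 'M[F]_e1)
    (tau : A -> 'M[F]_e2) (rho : A -> 'M[F]_d) U :
  isomorphic sigma tau -> isomorphic_to_submodule tau rho U ->
  isomorphic_to_submodule sigma rho U.
Proof.
move=> [B [Bfree /andP[_ Bfull] BP]] [C [Cfree /eqmxP eCU CP]].
exists (B *m C); split; first by rewrite /row_free mxrankMfree.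
  apply/eqmxP; apply: eqmx_trans eCU; apply: eqmxMfull.
  by rewrite -sub1mx.
by move=> a; rewrite mulmxA BP -!mulmxA CP.
Qed.

Lemma isomorphic_of_submodule e1 e2 d (sigma : A -> 'M[F]_e1)
    (tau : A -> 'M[F]_e2) (rho : A -> 'M[F]_d) U :
  isomorphic_to_submodule sigma rho U -> isomorphic_to_submodule tau rho U ->
  isomorphic sigma tau.
Proof.
move=> [B [Bfree /eqmxP eBU BP]] [C [Cfree /eqmxP eCU CP]].
have BC : (B <= C)%MS by rewrite eBU eCU.
have CB : (C <= B)%MS by rewrite eBU eCU.
have defB : B *m pinvmx C *m C = B by rewrite mulmxKpV.
exists (B *m pinvmx C); split.
- by rewrite /row_free -(mxrankMfree _ Cfree) defB.
- rewrite submx1 sub1mx /row_full -(mxrankMfree _ Cfree) defB.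
  have -> : \rank B = \rank C by apply/eqP; rewrite eqn_leq !mxrankS.
  by [].
- move=> a; apply: (row_free_inj Cfree).
  by rewrite -mulmxA defB BP -[RHS]mulmxA CP mulmxA defB.
Qed.

Lemma isomorphic_sym e1 e2 (sigma : A -> 'M[F]_e1) (tau : A -> 'M[F]_e2) :
  isomorphic sigma tau -> isomorphic tau sigma.
Proof.
move=> h; apply: isomorphic_of_submodule (h).
exists 1%:M; split; first by rewrite row_free_unit unitmx1.
  by rewrite submx_refl.
by move=> a; rewrite mul1mx mulmx1.
Qed.

(** Schur's lemma: the kernel is a proper submodule of an irreducible module. *)
Lemma intertwiner_free e d (sigma : A -> 'M[F]_e) (rho : A -> 'M[F]_d)
    (B : 'M[F]_(e, d)) :
  irreducible sigma -> (forall a, sigma a *m B = B *m rho a) -> B != 0 ->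
  row_free B.
Proof.
move=> [_ _ minsub] BP Bn0.
have kerP : submodule sigma (kermx B).
  by move=> a; rewrite sub_kermx -mulmxA BP mulmxA mulmx_ker mul0mx.
rewrite -kermx_eq0; apply: contraNT Bn0 => ker_n0.
have := minsub _ kerP (submx1 _) ker_n0.
by rewrite sub_kermx mul1mx.
Qed.

Lemma submodule_intertwiner e d (sigma : A -> 'M[F]_e) (rho : A -> 'M[F]_d)
    (B : 'M[F]_(e, d)) :
  (forall a, sigma a *m B = B *m rho a) -> submodule rho <<B>>%MS.
Proof.
move=> BP a; rewrite (eqmx_stable _ (genmxE B)) -[stablemx _ _]/(_ <= _)%MS.
by rewrite -BP submxMl.
Qed.

Lemma submodule_sum d (rho : A -> 'M[F]_d) (I : finType) (P : pred I) (U : I -> 'M[F]_d) :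
  (forall i, submodule rho (U i)) -> submodule rho (\sum_(i | P i) U i)%MS.
Proof.
move=> UP a; rewrite sumsmxMr; apply/sumsmx_subP => i Pi.
by rewrite (sumsmx_sup i) // UP.
Qed.

(** The projections along a decomposition into submodules are intertwiners: write
    rho a = p * rho a + q * rho a for the two complementary projections p and q,
    where the first term stays in [U] and the second one in [V], and project. *)
Lemma proj_mx_comm d (rho : A -> 'M[F]_d) (U V : 'M[F]_d) a :
  submodule rho U -> submodule rho V -> (U :&: V = 0)%MS ->
  (1%:M <= U + V)%MS ->
  proj_mx U V *m rho a = rho a *m proj_mx U V.
Proof.
move=> UP VP dx UV1.
set p := proj_mx U V; set q := proj_mx V U.
have pq : p + q = 1%:M.
  by rewrite -[p]mul1mx -[q]mul1mx add_proj_mx.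
have pU : (p *m rho a <= U)%MS.
  by apply: submx_trans (UP a); apply: submxMr; rewrite -[p]mul1mx proj_mx_sub.
have qV : (q *m rho a <= V)%MS.
  by apply: submx_trans (VP a); apply: submxMr; rewrite -[q]mul1mx proj_mx_sub.
rewrite -[rho a in RHS]mul1mx -pq 2!mulmxDl.
by rewrite (proj_mx_id dx pU) (proj_mx_0 dx qV) addr0.
Qed.

Section Decomposition.
Variables (d k : nat) (rho : A -> 'M[F]_d) (U : 'I_k -> 'M[F]_d).
Hypothesis dec : simple_decomposition rho U.

Definition isotypic e (sigma : A -> 'M[F]_e) : 'M[F]_d :=
  (\sum_(i | `[< isomorphic_to_submodule sigma rho (U i) >]) U i)%MS.

Lemma rank_isotypic e (sigma : A -> 'M[F]_e) :
  \rank (isotypic sigma) =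
    (#|[set i | `[< isomorphic_to_submodule sigma rho (U i) >]]| * e)%N.
Proof.
have [_ /mxdirect_sumsP dx _] := dec.
rewrite /isotypic.
pose P i := `[< isomorphic_to_submodule sigma rho (U i) >].
have /mxdirectP /= -> : mxdirect (\sum_(i | P i) U i).
  apply/mxdirect_sumsP => i Pi; apply/eqP; rewrite -submx0 -[X in (_ <= X)%MS](dx i isT).
  rewrite capmxS //. apply/sumsmx_subP => j /andP[_ ji].
  by rewrite (sumsmx_sup j).
rewrite (eq_bigr (fun _ => e)); last first.
  by move=> i /asboolP /isomorphic_to_submodule_rank.
by rewrite sum_nat_const; congr (_ * _)%N; apply: eq_card => i; rewrite !inE.
Qed.

(** The projection of [W] to a summand [U i] is zero or an isomorphism, so only
    the summands isomorphic to [sigma] contribute to [W]. *)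
Lemma sub_isotypic e (sigma : A -> 'M[F]_e) (W : 'M[F]_d) :
  irreducible sigma -> isomorphic_to_submodule sigma rho W ->
  (W <= isotypic sigma)%MS.
Proof.
move=> irr [B [Bfree /eqmxP eBW BP]].
have [simU dx /eqmxP U1] := dec.
rewrite -eBW.
have subU i : submodule rho (U i) by case: (simU i).
pose Vi i : 'M[F]_d := (\sum_(j | j != i) U j)%MS.
have subV i : submodule rho (Vi i) by apply: submodule_sum.
have dxi i : (U i :&: Vi i = 0)%MS by move/mxdirect_sumsP: dx; apply.
have Ui1 i : (1%:M <= U i + Vi i)%MS.
  by rewrite -U1 (bigD1 i).
have BPi i : forall a, sigma a *m (B *m proj_mx (U i) (Vi i)) =
                     (B *m proj_mx (U i) (Vi i)) *m rho a.
  move=> a; rewrite mulmxA BP -mulmxA -[RHS]mulmxA.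
  by rewrite (proj_mx_comm a (subU i) (subV i) (dxi i)).
have -> : B = \sum_i (B *m proj_mx (U i) (Vi i)).
  have /sub_dsumsmx -/(_ dx) [C CU -> uniqC] : (B <= \sum_i U i)%MS by rewrite U1 submx1.
  apply: eq_bigr => i _; rewrite (bigD1 i) //= mulmxDl (proj_mx_id (dxi i)) ?CU //.
  rewrite (proj_mx_0 (dxi i)) ?addr0 //.
  by apply: summx_sub_sums => j _; apply: CU.
apply: summx_sub => i _.
have [->|n0] := eqVneq (B *m proj_mx (U i) (Vi i)) 0; first exact: sub0mx.
apply: submx_trans (proj_mx_sub _ _ _) _.
rewrite /isotypic (sumsmx_sup i) //; apply/asboolP.
exists (B *m proj_mx (U i) (Vi i)); split=> //.
  exact: intertwiner_free (BPi i) n0.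
rewrite proj_mx_sub /=.
have [_ _ /(_ <<B *m proj_mx (U i) (Vi i)>>%MS)] := simU i.
rewrite !genmxE; apply => //.
- exact: submodule_intertwiner (BPi i).
- exact: proj_mx_sub.
- by rewrite -submx0 genmxE submx0.
Qed.

End Decomposition.

(** By [sub_isotypic] the isotypic components of [sigma] in two decompositions
    contain each other; compare their dimensions. *)
Lemma multiplicity_unique e d (sigma : A -> 'M[F]_e) (rho : A -> 'M[F]_d)
    k (U : 'I_k -> 'M[F]_d) m :
  irreducible sigma -> simple_decomposition rho U ->
  has_multiplicity sigma rho m ->
  #|[set i | `[< isomorphic_to_submodule sigma rho (U i) >]]| = m.
Proof.
move=> irr decU [k' [U' [decU' <-]]].
have e0 : (0 < e)%N.
  by case: irr => _; rewrite -mxrank_eq0 mxrank1 lt0n.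
apply/eqP; rewrite -(eqn_pmul2r e0) -!rank_isotypic // eqn_leq.
by rewrite !mxrankS //; apply/sumsmx_subP => i /asboolP /sub_isotypic; apply.
Qed.
(** The matrix of the restriction of [X] to the stable subspace [U], in the basis
    [row_base U]. *)
Definition restrict_mx d (U X : 'M[F]_d) : 'M[F]_(\rank U) :=
  row_base U *m X *m pinvmx (row_base U).

Section RestrictMx.
Variables (d : nat) (U : 'M[F]_d).

Lemma restrict_mxK (X : 'M[F]_d) :
  stablemx U X -> restrict_mx U X *m row_base U = row_base U *m X.
Proof. by rewrite -stablemx_row_base => /mulmxKpV. Qed.

Lemma restrict_mx1 : restrict_mx U 1%:M = 1%:M.
Proof. by rewrite /restrict_mx mulmx1 mulmxVp ?row_base_free. Qed.

Lemma restrict_mxM (X Y : 'M[F]_d) : stablemx U X -> stablemx U Y ->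
  restrict_mx U (X *m Y) = restrict_mx U X *m restrict_mx U Y.
Proof.
move=> UX UY; apply: (row_free_inj (row_base_free U)).
rewrite -(mulmxA _ _ (row_base U)) !restrict_mxK ?stablemxM //.
by rewrite (mulmxA _ X) (mulmxA _ (row_base U)) restrict_mxK.
Qed.

Lemma restrict_mx_linear : linear (restrict_mx U).
Proof.
move=> a X Y; rewrite /restrict_mx mulmxDr mulmxDl.
by rewrite -scalemxAr -scalemxAl.
Qed.

Lemma restrict_mx_isomorphic (rho : A -> 'M[F]_d) : submodule rho U ->
  isomorphic_to_submodule (fun a => restrict_mx U (rho a)) rho U.
Proof.
move=> UP; exists (row_base U); split; first exact: row_base_free.
  by rewrite !eq_row_base submx_refl.
by move=> a; apply: restrict_mxK.
Qed.

(** Submodules of [U] in coordinates are lifted to submodules of the ambient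
    module through [row_base U]. *)
Lemma restrict_mx_irreducible (rho : A -> 'M[F]_d) : simple_submodule rho U ->
  irreducible (fun a => restrict_mx U (rho a)).
Proof.
case=> UP Un0 Umin; split.
- by move=> a; apply: submx1.
- by rewrite -mxrank_eq0 mxrank1 mxrank_eq0.
move=> W WP _ Wn0; have freeU := row_base_free U.
have WUP : submodule rho <<W *m row_base U>>%MS.
  move=> a; rewrite (eqmx_stable _ (genmxE _)) -mulmxA -restrict_mxK // mulmxA.
  exact: submxMr (WP a).
have := Umin _ WUP; rewrite !genmxE => UW.
rewrite -(submxMfree _ _ freeU) mul1mx eq_row_base; apply: UW.
  by apply: submx_trans (submxMl _ _) _; rewrite eq_row_base.
by rewrite -submx0 genmxE submx0 mulmx_free_eq0.
Qed.
End RestrictMx.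
End Operators.

(** * Set partitions with one extra block *)

(** Both the boundary points and the points of a stacking of diagrams are enlarged
    by a through-string: the new set [Y] is the disjoint union of a copy of the old
    set [X] and of a set [C] of new points, which form a single block. *)
Section ExtraBlock.
Variables (X Y : finType) (f : X -> Y) (C : {set Y}).
Hypothesis f_inj : injective f.
Hypothesis f_notin : forall x, f x \notin C.
Hypothesis f_onto : forall y, y \notin C -> exists x, y = f x.
Hypothesis C_n0 : C != set0.

Definition add_block (P : {set {set X}}) : {set {set Y}} :=
  C |: [set f @: B | B : {set X} in P].

Lemma forall_add_block P (Q : pred {set Y}) :
  [forall B in add_block P, Q B] = Q C && [forall B in P, Q (f @: B)].
Proof.
apply/forall_inP/andP => [h|[QC /forall_inP h] B].
  split; first by apply: h; rewrite setU11.
  by apply/forall_inP => B BP; apply: h; rewrite setU1r // imset_f.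
by case/setU1P => [->//|/imsetP[B0 B0P ->]]; apply: h.
Qed.

Lemma mem_imset_block y (B : {set X}) : y \in f @: B -> y \notin C.
Proof. by case/imsetP => x _ ->. Qed.

Lemma imset_f_inj : injective (fun B : {set X} => f @: B).
Proof. exact: imset_inj. Qed.

Lemma partition_add_block P :
  finset.partition (add_block P) [set: Y] = finset.partition P [set: X].
Proof.
rewrite /finset.partition; congr [&& _, _ & _].
- rewrite /cover; apply/eqP/eqP => cov.
    apply/setP => x; rewrite inE.
    have : f x \in \bigcup_(B in add_block P) B by rewrite cov inE.
    case/bigcupP => B /setU1P[->|/imsetP[B0 B0P ->]].
      by rewrite (negPf (f_notin x)).
    by rewrite (mem_imset _ _ f_inj) => xB; apply/bigcupP; exists B0.
  apply/setP => y; rewrite inE; apply/bigcupP.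
  have [yC|/f_onto[x ->]] := boolP (y \in C); first by exists C; rewrite ?setU11.
  have : x \in \bigcup_(B in P) B by rewrite cov inE.
  case/bigcupP => B BP xB; exists (f @: B); last exact: imset_f.
  by rewrite setU1r // imset_f.
- apply/trivIsetP/trivIsetP => triv A B.
    move=> AP BP AB; rewrite -(imset_disjoint f_inj).
    by apply: triv; rewrite ?setU1r ?imset_f // (inj_eq imset_f_inj).
  have dC (B0 : {set X}) : [disjoint C & f @: B0].
    rewrite disjoint_sym disjoint_subset; apply/subsetP => y yB.
    by rewrite inE; apply: mem_imset_block yB.
  case/setU1P => [->|/imsetP[A0 A0P ->]]; case/setU1P => [->|/imsetP[B0 B0P ->]].
  + by rewrite eqxx.
  + by move=> _; apply: dC.
  + by move=> _; rewrite disjoint_sym; apply: dC.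
  + rewrite (inj_eq imset_f_inj) => A0B0; rewrite (imset_disjoint f_inj).
    exact: triv.
- congr (~~ _); rewrite in_setU1 eq_sym (negPf C_n0) /=.
  by rewrite -{1}(imset0 f) (mem_imset _ _ imset_f_inj).
Qed.

(** A path that starts in the copy of [X] cannot leave it. *)
Lemma connect_add_block (e : rel X) (e' : rel Y) :
  (forall x y, e' (f x) (f y) = e x y) ->
  (forall x y, y \in C -> e' (f x) y = false) ->
  (forall x y, connect e' (f x) (f y) = connect e x y)
  /\ (forall x y, y \in C -> connect e' (f x) y = false).
Proof.
move=> e'f e'C.
have lift_path x p : path e' (f x) p -> exists2 q, path e x q & p = map f q.
  elim: p x => [|y p IHp] x /=; first by exists [::].
  have [yC|/f_onto[z ->]] := boolP (y \in C); first by rewrite e'C.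
  by rewrite e'f => /andP[xz /IHp[q zq ->]]; exists (z :: q); rewrite //= xz.
split=> x y.
  apply/connectP/connectP => [[p /lift_path[q xq ->]]|[q xq ->]].
    by rewrite last_map => /f_inj ->; exists q.
  exists (map f q); rewrite ?last_map //.
  by rewrite path_map; apply: sub_path xq => a b /=; rewrite e'f.
move=> yC; apply/connectP => -[p /lift_path[q _ ->]].
by rewrite last_map => yE; move: yC; rewrite yE (negPf (f_notin _)).
Qed.

Lemma equivalence_partition_add_block (r : rel X) (r' : rel Y) :
  (forall x y, r' (f x) (f y) = r x y) ->
  (forall x y, y \in C -> r' (f x) y = false) ->
  (forall x y, y \in C -> r' y (f x) = false) ->
  {in C &, forall x y, r' x y} ->
  equivalence_partition r' [set: Y] = add_block (equivalence_partition r [set: X]).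
Proof.
move=> r'f r'fC r'Cf r'C.
have clf x : [set y in [set: Y] | r' (f x) y] = f @: [set y in [set: X] | r x y].
  apply/setP => y; rewrite !inE /=.
  have [yC|/f_onto[z ->]] := boolP (y \in C).
    by rewrite r'fC //; apply/esym/negP => /mem_imset_block; rewrite yC.
  by rewrite (mem_imset _ _ f_inj) !inE r'f.
have clC z : z \in C -> [set y in [set: Y] | r' z y] = C.
  move=> zC; apply/setP => y; rewrite !inE /=.
  have [yC|/f_onto[x ->]] := boolP (y \in C); first by rewrite r'C.
  by rewrite r'Cf.
apply/setP => K; apply/imsetP/setU1P => [[y _ ->]|[->|/imsetP[B /imsetP[x _ ->] ->]]].
- have [yC|/f_onto[x ->]] := boolP (y \in C); first by rewrite clC //; left.
  by right; rewrite clf !imset_f.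
- by case/set0Pn: C_n0 => z zC; exists z; rewrite ?clC.
- by exists (f x); rewrite ?clf.
Qed.

End ExtraBlock.

(** * Diagrams with an additional through-string *)

Section ThroughString.
Variable n : nat.

Definition through_string : {set boundary n.+1} :=
  [set (inl ord_max : boundary n.+1); inr ord_max].

Lemma lift_max_widen (i : 'I_n) : lift ord_max i = widen_ord (leqnSn n) i.
Proof. by apply: ord_inj; apply: lift_max. Qed.

Lemma widen_neq_max (i : 'I_n) : (widen_ord (leqnSn n) i == ord_max) = false.
Proof. by apply/negbTE; rewrite -(inj_eq val_inj) /= neq_ltn ltn_ord. Qed.

Lemma widen_point_inj : injective (@widen_point n).
Proof. by move=> [i|i] [j|j] //= [/val_inj ->]. Qed.

Lemma widen_point_notin x : widen_point x \notin through_string.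
Proof.
by case: x => i; rewrite !inE /= /eq_op /= ?widen_neq_max ?orbF.
Qed.

Lemma widen_point_onto y : y \notin through_string -> exists x, y = @widen_point n x.
Proof.
case: y => i; rewrite !inE /eq_op /= ?orbF /=;
  case: (unliftP ord_max i) => [j ->|->]; rewrite ?eqxx // => _.
  by exists (inl j); rewrite lift_max_widen.
by exists (inr j); rewrite lift_max_widen.
Qed.

Lemma through_string_n0 : through_string != set0.
Proof. by apply/set0Pn; exists (inl ord_max); rewrite !inE eqxx. Qed.

Lemma add_through_stringE (p : {set {set boundary n}}) :
  add_through_string p = add_block (@widen_point n) through_string p.
Proof. by []. Qed.

Definition crossing m (B1 B2 : {set boundary m}) :=
  [exists x in B1, exists z in B1, exists y in B2, exists t in B2,
        [&& planar_rank x < planar_rank y, planar_rank y < planar_rank z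
          & planar_rank z < planar_rank t]%N].

Lemma crossingP m (B1 B2 : {set boundary m}) :
  reflect (exists x z y t, [/\ x \in B1, z \in B1, y \in B2, t \in B2 &
     [&& planar_rank x < planar_rank y, planar_rank y < planar_rank z
          & planar_rank z < planar_rank t]%N]) (crossing B1 B2).
Proof.
apply: (iffP exists_inP).
  case=> x xB /exists_inP[z zB /exists_inP[y yB /exists_inP[t tB h]]].
  by exists x, z, y, t.
move=> [x [z [y [t [xB zB yB tB h]]]]].
exists x => //; apply/exists_inP; exists z => //; apply/exists_inP; exists y => //.
by apply/exists_inP; exists t.
Qed.

Lemma planar_rank_widen (x y : boundary n) :
  (planar_rank (widen_point x) < planar_rank (widen_point y))%N =
  (planar_rank x < planar_rank y)%N.
Proof. by case: x => -[x hx]; case: y => -[y hy] /=; lia. Qed.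

(** The two ends of the through-string are consecutive in the planar order, hence
    no block can cross it. *)
Lemma planar_rank_string x : x \in through_string ->
  (n <= planar_rank x <= n.+1)%N.
Proof. by rewrite !inE => /orP[] /eqP-> /=; lia. Qed.

Lemma crossing_widen (B1 B2 : {set boundary n}) :
  crossing ((@widen_point n) @: B1) ((@widen_point n) @: B2) = crossing B1 B2.
Proof.
apply/crossingP/crossingP => [[x [z [y [t [xB zB yB tB h]]]]]|].
  case/imsetP: xB h => x' xB ->; case/imsetP: yB => y' yB ->.
  case/imsetP: zB => z' zB ->; case/imsetP: tB => t' tB ->.
  by rewrite !planar_rank_widen; exists x', z', y', t'.
move=> [x [z [y [t [xB zB yB tB h]]]]].
exists (widen_point x), (widen_point z), (widen_point y), (widen_point t).
by rewrite !planar_rank_widen !imset_f.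
Qed.

Lemma crossing_string_l B : crossing through_string B = false.
Proof.
apply/crossingP => -[x [z [y [t [xS zS _ _]]]]].
by have := planar_rank_string xS; have := planar_rank_string zS; lia.
Qed.

Lemma crossing_string_r B : crossing B through_string = false.
Proof.
apply/crossingP => -[x [z [y [t [_ _ yS tS]]]]].
by have := planar_rank_string yS; have := planar_rank_string tS; lia.
Qed.

Lemma ccw_rank_widen (x : boundary n) : ccw_rank (widen_point x) = (ccw_rank x).+1.
Proof. by case: x => -[i hi] /=; lia. Qed.

(** The upper right corner moves to the new string, so all labels a and b of the
    old points are exchanged, and a block of size two still joins an a to a b.  Read
    from left to right, the equality shows that a product of diagrams is sharp as
    soon as it is so after addition of the through-string. *)
Lemma is_sharp_add_through_string (p : {set {set boundary n}}) :
  is_sharp (add_through_string p) = is_sharp p.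
Proof.
rewrite /is_sharp add_through_stringE.
rewrite (partition_add_block widen_point_inj widen_point_notin widen_point_onto
  through_string_n0).
congr [&& _, _, _ & _].
- rewrite forall_add_block {1}/through_string cards2 /=.
  by apply: eq_forallb => B; rewrite card_imset //; apply: widen_point_inj.
- rewrite /noncrossing forall_add_block (_ : [forall B in _, _] = true); last first.
    by apply/forall_inP => B _; rewrite -/(crossing _ _) crossing_string_l.
  apply: eq_forallb => B; congr (_ ==> _).
  rewrite forall_add_block -/(crossing _ _) crossing_string_r /=.
  apply: eq_forallb => B'; congr (_ ==> _).
  rewrite -/(crossing _ _) crossing_widen -/(crossing _ _).
  by rewrite (inj_eq (imset_inj widen_point_inj)).
- rewrite /label_alternating forall_add_block (_ : (_ ==> _) = true); last first.
    apply/implyP => _; rewrite (_ : [set x in _ | _] = [set inr ord_max]) ?cards1 //.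
    apply/setP => x; rewrite !inE; case: eqP => [->|_] /=; first by rewrite subnn.
    case: eqP => [->|] //=; lia.
  apply: eq_forallb => B; congr (_ ==> _).
  rewrite card_imset; last exact: widen_point_inj.
  case: eqP => //= B2.
  rewrite (_ : [set x in _ | _] =
      @widen_point n @: (B :\: [set x in B | odd (ccw_rank x)])).
    rewrite card_imset; last exact: widen_point_inj.
    rewrite cardsD B2 (setIidPr _); last by apply/subsetP => x; rewrite inE => /andP[].
    have : (#|[set x in B | odd (ccw_rank x)]| <= 2)%N.
      by rewrite -B2 subset_leq_card //; apply/subsetP => x; rewrite inE => /andP[].
    by case: #|_| => [|[|[|]]].
  apply/setP => y; rewrite inE; apply/andP/imsetP.
    move=> [/imsetP[x xB ->]]; rewrite ccw_rank_widen /= => o; exists x => //.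
    by rewrite !inE xB o.
  case=> x; rewrite !inE => /andP[+ xB] ->; rewrite xB /= => o.
  by rewrite imset_f // ccw_rank_widen.
Qed.

End ThroughString.

(** * Stacking diagrams with through-strings *)

Section Stacking.
Variable n : nat.

Definition widen_stack (x : stack_point n) : stack_point n.+1 :=
  match x with
  | inl (inl i) => top (widen_ord (leqnSn n) i)
  | inl (inr i) => mid (widen_ord (leqnSn n) i)
  | inr i => bot (widen_ord (leqnSn n) i)
  end.

Definition stack_string : {set stack_point n.+1} :=
  [set top ord_max; mid ord_max; bot ord_max].

Lemma widen_stack_inj : injective widen_stack.
Proof. by move=> [[i|i]|i] [[j|j]|j] //= [/val_inj ->]. Qed.

Lemma widen_stack_notin x : widen_stack x \notin stack_string.
Proof.
apply/negP; rewrite !inE; case: x => [[i|i]|i] /orP[/orP[]|] /eqP // [ieqn];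
  by have := ltn_ord i; rewrite ieqn ltnn.
Qed.

Lemma widen_stack_onto y : y \notin stack_string -> exists x, y = widen_stack x.
Proof.
case: y => [[i|i]|i]; case: (unliftP ord_max i) => [j ->|->];
  rewrite ?lift_max_widen ?inE ?eqxx ?orbT // => _.
- by exists (inl (inl j)).
- by exists (inl (inr j)).
- by exists (inr j).
Qed.

Lemma stack_string_n0 : stack_string != set0.
Proof. by apply/set0Pn; exists (top ord_max); rewrite !inE eqxx. Qed.

(** The arguments for the upper and for the lower diagram of a stacking are the same;
    [g] and [g'] stand for [in_upper] or [in_lower] at the two levels. *)
Section SameBlock.
Variables (g : boundary n -> stack_point n) (g' : boundary n.+1 -> stack_point n.+1).
Hypothesis g'_widen : forall x, g' (widen_point x) = widen_stack (g x).
Hypothesis g'_string : forall x, x \in through_string n -> g' x \in stack_string.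

Lemma imset_widen (B : {set boundary n}) :
  g' @: (@widen_point n @: B) = widen_stack @: (g @: B).
Proof. by rewrite -!imset_comp; apply: eq_imset => x /=. Qed.

Lemma same_block_sym m (h : boundary m -> stack_point m) p :
  symmetric (same_block h p).
Proof. by move=> x y; apply: eq_existsb => B; rewrite [(x \in _) && _]andbC. Qed.

Lemma same_block_widen p x y :
  same_block g' (add_through_string p) (widen_stack x) (widen_stack y) =
  same_block g p x y.
Proof.
apply/exists_inP/exists_inP => [[B /setU1P[->|/imsetP[B0 B0p ->]] /andP[]]|].
- by case/imsetP => z /g'_string zS xz; case/negP: (widen_stack_notin x); rewrite xz.
- rewrite imset_widen !(mem_imset _ _ widen_stack_inj) => xB yB.
  by exists B0; rewrite ?xB.
case=> B Bp /andP[xB yB]; exists (@widen_point n @: B).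
  by rewrite setU1r // imset_f.
by rewrite imset_widen !imset_f.
Qed.

Lemma same_block_widen_string p x y : y \in stack_string ->
  same_block g' (add_through_string p) (widen_stack x) y = false.
Proof.
move=> yS; apply/exists_inP => -[B /setU1P[->|/imsetP[B0 B0p ->]] /andP[]].
- by case/imsetP => z /g'_string zS xz; case/negP: (widen_stack_notin x); rewrite xz.
- rewrite imset_widen => _ /imsetP[z _ yz].
  by case/negP: (widen_stack_notin z); rewrite -yz.
Qed.

Lemma same_block_string p :
  same_block g' (add_through_string p) (g' (inl ord_max)) (g' (inr ord_max)).
Proof.
apply/exists_inP; exists (through_string n); first exact: setU11.
by rewrite !imset_f // !inE eqxx ?orbT.
Qed.
End SameBlock.

Lemma in_upper_widen x : in_upper (widen_point x) = widen_stack (in_upper x).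
Proof. by case: x. Qed.

Lemma in_lower_widen x : in_lower (widen_point x) = widen_stack (in_lower x).
Proof. by case: x. Qed.

Lemma outer_widen x : outer (widen_point x) = widen_stack (outer x).
Proof. by case: x. Qed.

Lemma in_upper_string x : x \in through_string n -> in_upper x \in stack_string.
Proof. by rewrite !inE => /orP[] /eqP-> /=; rewrite eqxx ?orbT. Qed.

Lemma in_lower_string x : x \in through_string n -> in_lower x \in stack_string.
Proof. by rewrite !inE => /orP[] /eqP-> /=; rewrite eqxx ?orbT. Qed.

Lemma outer_string x : x \in through_string n -> outer x \in stack_string.
Proof. by rewrite !inE => /orP[] /eqP-> /=; rewrite eqxx ?orbT. Qed.

Lemma stack_conn_sym m (p q : {set {set boundary m}}) : symmetric (stack_conn p q).
Proof.
apply: sym_connect_sym => x y /=.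
by rewrite same_block_sym [X in _ || X]same_block_sym.
Qed.

Section Add.
Variables p q : {set {set boundary n}}.
Local Notation conn' := (stack_conn (add_through_string p) (add_through_string q)).

Lemma stack_conn_widen :
  (forall x y, conn' (widen_stack x) (widen_stack y) = stack_conn p q x y) /\
  (forall x y, y \in stack_string -> conn' (widen_stack x) y = false).
Proof.
apply: (connect_add_block widen_stack_inj widen_stack_notin widen_stack_onto) => x y.
  rewrite (same_block_widen in_upper_widen in_upper_string).
  by rewrite (same_block_widen in_lower_widen in_lower_string).
move=> yS; rewrite (same_block_widen_string in_upper_widen in_upper_string) //.
by rewrite (same_block_widen_string in_lower_widen in_lower_string).
Qed.

Lemma stack_conn_string : {in stack_string &, forall x y, conn' x y}.
Proof.
have toM x : x \in stack_string -> conn' (mid ord_max) x.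
  rewrite !inE => /orP[/orP[]|] /eqP->; last 1 first.
  - by apply/connect1; rewrite (same_block_string (@in_lower n.+1)) orbT.
  - rewrite stack_conn_sym; apply/connect1.
    by rewrite (same_block_string (@in_upper n.+1)).
  - exact: connect0.
have ofM x : x \in stack_string -> conn' x (mid ord_max).
  by rewrite stack_conn_sym; apply: toM.
by move=> x y xS yS; apply: connect_trans (ofM x xS) (toM y yS).
Qed.

Lemma stack_add_through_string :
  stack (add_through_string p) (add_through_string q) = add_through_string (stack p q).
Proof.
have [connE connF] := stack_conn_widen.
apply: (equivalence_partition_add_block (@widen_point_inj n)
  (@widen_point_notin n) (@widen_point_onto n)
  (@through_string_n0 n)) => [x y|x y yS|x y yS|x y xS yS].
- by rewrite !outer_widen connE.
- by rewrite outer_widen connF ?outer_string.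
- by rewrite stack_conn_sym outer_widen connF ?outer_string.
- by rewrite stack_conn_string ?outer_string.
Qed.

(** The only new component contains the outer points of the through-string, so it
    is not erased. *)
Lemma erased_components_add_through_string :
  erased_components (add_through_string p) (add_through_string q) = erased_components p q.
Proof.
have [connE connF] := stack_conn_widen.
rewrite /erased_components.
rewrite (equivalence_partition_add_block widen_stack_inj widen_stack_notin
  widen_stack_onto
  stack_string_n0 connE connF _ stack_conn_string); last first.
  by move=> x y yS; rewrite stack_conn_sym connF.
rewrite -(card_imset _ (imset_inj widen_stack_inj)).
apply: eq_card => K; rewrite !inE; apply/andP/imsetP.
  case=> /orP[/eqP->|/imsetP[K0 K0P ->]] /subsetP sub.
    have /sub : top ord_max \in stack_string by rewrite !inE eqxx.
    by case/imsetP.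
  exists K0 => //; rewrite inE K0P; apply/subsetP => x xK.
  have /sub : widen_stack x \in widen_stack @: K0 by rewrite imset_f.
  by case: x xK => [[i|i]|i] xK /imsetP[j _] //= _; rewrite imset_f.
case=> K0; rewrite inE => /andP[K0P /subsetP sub] ->.
split; first by rewrite imset_f ?orbT.
apply/subsetP => _ /imsetP[x /sub /imsetP[i _ ->] ->] /=.
by rewrite imset_f.
Qed.
End Add.

Lemma identity_diagramS : identity_diagram n.+1 = add_through_string (identity_diagram n).
Proof.
apply/setP => B; apply/imsetP/setU1P => [[i _ ->]|[->|/imsetP[_ /imsetP[i _ ->] ->]]].
- case: (unliftP ord_max i) => [j ->|->]; last by left.
  right; apply/imsetP; exists [set (inl j : boundary n); inr j].
    by apply/imsetP; exists j.
  by rewrite imsetU1 imset_set1 lift_max_widen.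
- by exists ord_max.
- by exists (widen_ord (leqnSn n) i); rewrite // imsetU1 imset_set1.
Qed.

End Stacking.

(** * The embedding of algebras and restriction of representations *)

Definition embed_sharp n (p : sharp n) : sharp n.+1 :=
  Sub (add_through_string (val p))
    (etrans (is_sharp_add_through_string (val p)) (valP p)).

Section Embedding.
Variables (R : realType) (delta : R) (n : nat).
Implicit Types f g : sharp_alg R n.

Lemma alg_embedE f r : alg_embed f r = \sum_(p | embed_sharp p == r) f p.
Proof. by rewrite ffunE; apply: eq_bigl => p; rewrite -(inj_eq val_inj). Qed.

Lemma alg_embed_linear : linear (@alg_embed R n).
Proof.
move=> a f g; apply/ffunP => r; rewrite !ffunE scaler_sumr -big_split /=.
by apply: eq_bigr => p _; rewrite !ffunE.
Qed.

HB.instance Definition _ := GRing.isLinear.Build R[i] (sharp_alg R n) (sharp_alg R n.+1)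
  _ (@alg_embed R n) alg_embed_linear.

(** The set of the indices is at most a singleton.  If [t] is not sharp the sum is
    empty, and then [add_through_string t] is not sharp either. *)
Lemma sum_embed (t : {set {set boundary n}}) (r : sharp n.+1) (c : R[i]) :
  \sum_(u : sharp n | (embed_sharp u == r) && (t == val u)) c =
  if add_through_string t == val r then c else 0.
Proof.
case: eqP => [tr|tr]; last first.
  rewrite big1 // => u /andP[/eqP ur /eqP tu].
  by case: tr; rewrite tu -ur.
have tS : is_sharp t by rewrite -is_sharp_add_through_string tr (valP r).
rewrite (big_pred1 (Sub t tS : sharp n)) // => u /=.
rewrite -[RHS](inj_eq val_inj) /= [in RHS]eq_sym andbC.
case: eqP => //= tu; rewrite -(inj_eq val_inj) /= -tu tr eqxx //.
Qed.

Lemma alg_embed_one : alg_embed (alg_one R n) = alg_one R n.+1.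
Proof.
apply/ffunP => r; rewrite alg_embedE ffunE identity_diagramS eq_sym.
transitivity (\sum_(u : sharp n |
    (embed_sharp u == r) && (identity_diagram n == val u)) (1 : R[i])).
  rewrite big_mkcondr /=; apply: eq_bigr => u _.
  by rewrite ffunE eq_sym; case: eqP.
by rewrite sum_embed; case: eqP.
Qed.

Lemma sum_alg_embed (K : sharp n.+1 -> R[i]) f :
  \sum_P K P * alg_embed f P = \sum_p K (embed_sharp p) * f p.
Proof.
rewrite [RHS](partition_big (@embed_sharp n) predT) //=.
apply: eq_bigr => P _; rewrite alg_embedE mulr_sumr.
by apply: eq_bigr => p /eqP->.
Qed.

(** Adding through-strings commutes with stacking and does not change the number
    of erased components; both products are thus expanded over pairs of diagrams
    of level [n]. *)
Lemma alg_embed_mul f g :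
  alg_embed (alg_mul delta f g) = alg_mul delta (alg_embed f) (alg_embed g).
Proof.
apply/ffunP => r; rewrite alg_embedE [RHS]ffunE.
pose c m (p q : sharp m) := (delta%:C)%C ^+ erased_components (val p) (val q).
pose K P Q := if stack (val P) (val Q) == val r then c n.+1 P Q else 0.
transitivity (\sum_p \sum_q K (embed_sharp p) (embed_sharp q) * f p * g q).
  under eq_bigr => u _ do rewrite ffunE.
  rewrite exchange_big /=; apply: eq_bigr => p _.
  rewrite (exchange_big_dep predT) //=; apply: eq_bigr => q _.
  rewrite sum_embed /K /= stack_add_through_string /c /=.
  rewrite erased_components_add_through_string.
  by case: eqP => // _; rewrite !mul0r.
transitivity (\sum_P \sum_Q K P Q * alg_embed f P * alg_embed g Q).
  under [RHS]eq_bigr => P _ do rewrite sum_alg_embed.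
  rewrite exchange_big [RHS]exchange_big /=; apply: eq_bigr => q _.
  under [RHS]eq_bigr => P _ do rewrite mulrAC.
  rewrite (sum_alg_embed (fun P => K P (embed_sharp q) * g q)).
  by apply: eq_bigr => p _; rewrite mulrAC.
apply: eq_bigr => P _; rewrite [RHS]big_mkcond /=; apply: eq_bigr => Q _.
by rewrite /K; case: eqP => // _; rewrite !mul0r.
Qed.

End Embedding.

Section Representations.
Variables (R : realType) (delta : R).

Definition restrict_rep n (V : representation delta n.+1) : representation delta n.
Proof.
refine (@Representation R delta n (rep_dim V)
  (V \o (@alg_embed R n) : {linear sharp_alg R n -> 'M[R[i]]_(rep_dim V)}) _ _).
- by rewrite /= alg_embed_one rep_one.
- by move=> f g; rewrite /= alg_embed_mul rep_mul.
Defined.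

Section Subrepresentation.
Variables (n : nat) (V : representation delta n) (U : 'M[R[i]]_(rep_dim V)).
Hypothesis UV : submodule V U.

Definition sub_rep_mx (f : sharp_alg R n) : 'M[R[i]]_(\rank U) := restrict_mx U (V f).

Lemma sub_rep_mx_linear : linear sub_rep_mx.
Proof. by move=> a f g; rewrite /sub_rep_mx linearP restrict_mx_linear. Qed.

HB.instance Definition _ := GRing.isLinear.Build R[i] (sharp_alg R n) 'M[R[i]]_(\rank U)
  _ sub_rep_mx sub_rep_mx_linear.

Lemma sub_rep_one : sub_rep_mx (alg_one R n) = 1%:M.
Proof. by rewrite /sub_rep_mx rep_one restrict_mx1. Qed.

Lemma sub_rep_mul f g : sub_rep_mx (alg_mul delta f g) = sub_rep_mx f *m sub_rep_mx g.
Proof. by rewrite /sub_rep_mx rep_mul restrict_mxM. Qed.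

Definition sub_rep : representation delta n :=
  @Representation R delta n (\rank U) sub_rep_mx sub_rep_one sub_rep_mul.

End Subrepresentation.
End Representations.

(** * Dimensions of the irreducible representations *)

Lemma boundary0_set (B : {set boundary 0}) : B = set0.
Proof. by apply/setP => -[[i hi]|[i hi]]. Qed.

Lemma sharp0_val (p : sharp 0) : val p = identity_diagram 0.
Proof.
transitivity (set0 : {set {set boundary 0}}).
  apply/setP => B; rewrite inE [B]boundary0_set; apply/negbTE.
  by case/and4P: (valP p) => /and3P[].
by apply/esym/setP => B; rewrite inE; apply/imsetP => -[[]].
Qed.

Section Dimensions.
Variables (R : realType) (delta : R).

Lemma rep0_scalar (V : representation delta 0) f : exists c, V f = c%:M.
Proof.
exists (\sum_p f p); rewrite -scalemx1 -(rep_one V) -linearZ; congr (V _).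
apply/ffunP => r; rewrite !ffunE sharp0_val eqxx.
rewrite (big_pred1 r) => [|p]; first exact/esym/mulr1.
by apply/esym/eqP/val_inj; rewrite !sharp0_val.
Qed.

Lemma irreducible_rep0_dim (V : representation delta 0) :
  irreducible V -> rep_dim V = 1%N.
Proof.
case=> _ Vn0 Vmin.
have V0 : (0 < rep_dim V)%N by move: Vn0; rewrite -mxrank_eq0 mxrank1 lt0n.
pose i := Ordinal V0; pose W : 'M[R[i]]_(rep_dim V) := delta_mx i i.
have /mxrankS : (1%:M <= W)%MS.
  apply: Vmin; rewrite ?submx1 // -?mxrank_eq0 ?mxrank_delta // => f.
  by have [c ->] := rep0_scalar V f; apply: stablemxC.
by rewrite mxrank1 mxrank_delta => h; apply/eqP; rewrite eqn_leq h.
Qed.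

Variable phi : forall N : nat, derooted 2 -> representation delta N.
Hypotheses (gen : generic delta) (branching : branching_isomorphism phi).

Lemma simple_submodule_vertex N (V : representation delta N) U :
  simple_submodule V U ->
  exists2 w, pascal_vertex N w & isomorphic_to_submodule (phi N w) V U.
Proof.
move=> simU; have [subU _ _] := simU.
have [w wN iso] := branching_surjective branching
  (V := sub_rep subU) (restrict_mx_irreducible simU).
exists w => //; apply: isomorphic_to_submodule_trans (isomorphic_sym iso) _.
exact: restrict_mx_isomorphic.
Qed.

(** Each summand of the restriction is some [phi N (v i)]; counting the summands
    by the value of [v i], which by uniqueness of multiplicities takes each
    neighbour of [w'] in the pascalization exactly once, gives the recursion. *)
Lemma rep_dimS N w' : pascal_vertex N.+1 w' ->
  rep_dim (phi N.+1 w') =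
    (\sum_(w <- nbrs w' | pascal_vertex N w) rep_dim (phi N w))%N.
Proof.
move=> w'N; set V := phi N.+1 w'.
have [k [U decU]] := gen.2 N (restrict_rep V).
have [simU dxU eqU1] := decU.
have [v vN Uv] := all_sig2 (fun i => cid2 (simple_submodule_vertex (simU i))).
have count w : pascal_vertex N w ->
    #|[pred i | v i == w]| = derooted_adjacent w w' :> nat.
  move=> wN; rewrite -(multiplicity_unique (branching_irreducible branching wN)
    decU (branching_edges branching wN w'N)).
  apply: eq_card => i; rewrite !inE; apply/eqP/asboolP => [<- //|Uw].
  apply: (branching_injective branching (vN i) wN).
  exact: isomorphic_of_submodule (Uv i) Uw.
have nbr_v i : v i \in nbrs w'.
  rewrite mem_nbrs; apply: contraT => /negPf vw'.
  have := count _ (vN i); rewrite vw' => /card0_eq/(_ i).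
  by rewrite !inE eqxx.
transitivity (\sum_i rep_dim (phi N (v i)))%N.
  transitivity (\rank (1%:M : 'M[R[i]]_(rep_dim V))); first by rewrite mxrank1.
  rewrite -(eqmx_rank eqU1) (mxdirectP dxU) /=.
  by apply: eq_bigr => i _; rewrite (isomorphic_to_submodule_rank (Uv i)).
transitivity (\sum_(w <- nbrs w' | pascal_vertex N w)
    \sum_(i | v i == w) rep_dim (phi N w))%N.
  rewrite (exchange_big_dep predT) //=; apply: eq_bigr => i _.
  rewrite -big_filter (_ : filter _ _ = [:: v i]) ?big_seq1 //.
  rewrite (eq_filter (a2 := pred1 (v i))) ?filter_pred1_uniq ?nbrs_uniq //.
  by move=> w /=; rewrite eq_sym; case: eqP => [->|_]; rewrite ?vN ?andbF.
rewrite -big_filter -[RHS]big_filter big_seq [RHS]big_seq.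
apply: eq_bigr => w; rewrite mem_filter mem_nbrs => /andP[wN ww'].
by rewrite sum_nat_const count // ww' mul1n.
Qed.

(** As [walk_number] vanishes off the pascalization, [rep_dimS] and [walk_numberS]
    are the same recursion. *)
Lemma rep_dim_walk_number N w : pascal_vertex N w ->
  (rep_dim (phi N w))%:R = walk_number 2 N (word w).
Proof.
elim: N w => [|N IHN] w wN.
  rewrite (irreducible_rep0_dim (branching_irreducible branching wN)).
  have /andP[sz _] := wN; rewrite /walk_number sub0n [(_ <= 0)%N]sz /=.
  by rewrite raney0r //; apply: (sumn_word_gt0 _ (word_valid w)).
rewrite rep_dimS // natr_sum big_mkcond /= walk_numberS // -(big_nbrs (walk_number 2 N)).
apply: eq_bigr => u _; case: ifP => [/IHN//|].
rewrite /pascal_vertex /walk_number /depth -/(word u).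
case: leqP => //= le; rewrite oddB // => /negbT; rewrite -addbN.
by case: odd; case: odd.
Qed.
End Dimensions.

Theorem proposition4p26 :
  (forall (s : nat) (w : derooted s) (n : nat),
     (2 <= s)%N -> ((depth (val w)).-1 <= 2 * n)%N ->
     fuss_bracket n w =
       (if odd (depth (val w))
        then Wk (@derooted_adjacent s) (2 * n) (derooted_root s) w
        else Wk (@derooted_adjacent s) (2 * n - 1) (derooted_root s) w)%:R)
  /\
  (forall (R : realType) (delta : R)
      (phi : forall N : nat, derooted 2 -> representation delta N),
     generic delta -> branching_isomorphism phi ->
     forall (w : derooted 2) (n : nat), ((depth (val w)).-1 <= 2 * n)%N ->
       (odd (depth (val w)) ->
          (rep_dim (phi (2 * n)%N w))%:R = fuss_bracket n w) /\
       (~~ odd (depth (val w)) ->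
          (rep_dim (phi (2 * n - 1)%N w))%:R = fuss_bracket n w)).
Proof.
split=> [s w n s2 le_w|R delta phi gen branching w n le_w].
  rewrite fuss_bracket_walk_number //; last exact: ltnW.
  by case: ifP => _; rewrite Wk_walk_number // ltnW.
have := word_valid w; rewrite -size_eq0 /= -/(depth (val w)) => /andP[_ d0].
rewrite fuss_bracket_walk_number //.
split=> [odd_w|even_w]; rewrite ?odd_w ?(negPf even_w);
  rewrite (rep_dim_walk_number gen branching) //;
  rewrite /pascal_vertex; simpl in *; lia.
Qed.
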